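(* Let $G$ be a finite soluble group with trivial center. Then $\vec\Delta_{\rm norm}(G)$ is strongly disconnected if and only if one of the following holds: (i) $G$ is a Frobenius group; (ii) $G$ is a $2$-Frobenius group with subgroups $K,H$ such that $K \lhd KH \lhd G$, $KH$ is a Frobenius group (with kernel $K$ and complement $H$) and $G/K$ is a Frobenius group with kernel $KH/K$, and such that $p \nmid r-1$ for all $p \in \pi(H)$ and all $r \in \pi(K)$.
   Context: For a group $G$ and $x,y\in G$, write $x\to y$ if $\langle x\rangle$ is normal in $\langle x,y\rangle$ (equivalently, $y$ normalizes $\langle x\rangle$), and $x\leftrightarrow y$ if both $x\to y$ and $y\to x$. The directed normalizing graph $\vec\Gamma_{\rm norm}(G)$ is the simple directed graph with vertex set $G$ and with an arc from $x$ to $y$ ($x\neq y$) whenever $x\to y$. $\mathrm{Univ}(G)$ is the set of those $x\in G$ with $x\leftrightarrow y$ for all $y\in G$. $\vec\Delta_{\rm norm}(G)$ is the induced subgraph of $\vec\Gamma_{\rm norm}(G)$ on $G\setminus\mathrm{Univ}(G)$. A directed graph is strongly connected if for every ordered pair of vertices $(u,v)$ there is a directed path from $u$ to $v$, and strongly disconnected if it is not strongly connected. A group $G$ is a $2$-Frobenius group if there are subgroups $K,H,L$ of $G$ such that $K$ and $KH$ are normal in $G$, $KH$ is a Frobenius group with kernel $K$ and complement $H$, and $G/K$ is a Frobenius group with kernel $KH/K$ and complement $L/K$. $\pi(A)$ denotes the set of primes dividing $|A|$. *)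

(* Defs.v *)
From mathcomp Require Import all_boot all_fingroup all_solvable.

Set Implicit Arguments.
Unset Strict Implicit.
Unset Printing Implicit Defensive.

Local Open Scope group_scope.

(* Pairs related by [arc] that are not both in [vertices] are ignored. *)
Record digraph (T : finType) := Digraph { vertices : {set T}; arc : rel T }.

Definition arcs_in (T : finType) (D : digraph T) : rel T :=
  [rel u v | [&& u \in vertices D, v \in vertices D & arc D u v]].

Definition induced (T : finType) (D : digraph T) (S : {set T}) : digraph T :=
  Digraph (vertices D :&: S) (arc D).

(* [connect] is the reflexive transitive closure, so it says precisely that
   there is a directed path, possibly of length 0. *)
Definition strongly_connected (T : finType) (D : digraph T) : Prop :=
  {in vertices D &, forall u v : T, connect (arcs_in D) u v}.

Definition strongly_disconnected (T : finType) (D : digraph T) : Prop :=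
  ~ strongly_connected D.

Section NormalizingGraph.

Variable gT : finGroupType.
Implicit Types (x y : gT) (G K H L : {group gT}).

(* x -> y *)
Definition norm_to : rel gT := [rel x y | <[x]> <| <<[set x; y]>>].

(* x <-> y *)
Definition norm_both : rel gT := [rel x y | norm_to x y && norm_to y x].

Definition Gamma_norm G : digraph gT :=
  Digraph G [rel x y | (x != y) && norm_to x y].

Definition Univ G : {set gT} :=
  [set x in G | [forall y in G, norm_both x y]].

Definition Delta_norm G : digraph gT := induced (Gamma_norm G) (G :\: Univ G).

(* Normality of the set product K * H in G includes its being contained in G;
   it is a subgroup because K is normal. *)
Definition two_Frobenius_with G K H L : Prop :=
  [/\ K <| G /\ K * H <| G,
      K \subset L /\ L \subset G,
      [Frobenius (K * H) = K ><| H]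
    & [Frobenius (G / K) = ((K * H) / K) ><| (L / K)]].

End NormalizingGraph.

(* Main.v *)
Require Import Defs.
From mathcomp Require Import all_boot all_fingroup all_solvable.
From mathcomp Require Import ssralg poly matrix mxalgebra mxpoly zmodp finalg.
From mathcomp Require Import finfield mxrepresentation mxabelem.

(* Since Z(G) = 1, the vertices are the nontrivial elements of G.  If G is
   Frobenius with complement H, no arc leaves the nontrivial elements of H.  If G
   is 2-Frobenius and satisfies the arithmetic condition, no arc leaves the
   nontrivial pi(H)'-elements.

   Conversely, let F be the Fitting subgroup; its nontrivial elements are all
   mutually reachable, because they commute with Z(F).  Let FQ/F be a minimal
   normal subgroup of G/F with Q a Sylow subgroup of FQ, so that G = F M for
   M = N_G(Q).  An element of prime order acting fixed-point-freely on F has a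
   conjugate in M that centralises a nontrivial element of Q.  Hence, if some
   nontrivial element of Q is mutually reachable with F, the graph is strongly
   connected.  Otherwise G is the semidirect product of F and M, and Z = Z(Q) is
   cyclic.  Either M acts semiregularly on F and G is Frobenius, or some x of prime
   order in M has fixed points in F; then H = C_M(Z) acts semiregularly on F, M is
   Frobenius with kernel H and complement C_M(x), and G is 2-Frobenius.  Finally, x
   normalises the subgroups of Z, which gives paths from H to F; and if p divides
   r - 1, with p in pi(H) and r in pi(F), then an element of order p of H has an
   eigenvector in an elementary abelian r-subgroup of F, which gives a path from F
   back to H. *)

Set Implicit Arguments.
Unset Strict Implicit.
Unset Printing Implicit Defensive.

Import GRing.Theory FiniteModule.

Local Open Scope group_scope.

(** * Fixed-point-free actions, and eigenvectors over finite fields *)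

Lemma prime_order_power (gT : finGroupType) (u : gT) :
  u != 1 -> exists2 x, x \in <[u]> & prime #[x].
Proof.
move=> ntu; have [] := @Cauchy _ (pdiv #[u]) <[u]>%G.
- by rewrite pdiv_prime ?order_gt1.
- by rewrite -orderE pdiv_dvd.
by move=> x ux ox; exists x; rewrite // ox pdiv_prime ?order_gt1.
Qed.

(** With [q = #|F|], the polynomial ['X^q - 'X] is the product of all ['X - a]. As it annihilates
    [A], the matrices [A - a] cannot all be invertible. *)
Lemma finField_eigenvalue (F : finFieldType) n (A : 'M[F]_n.+1) :
  (A ^+ #|F| = A)%R -> exists a, eigenvalue A a.
Proof.
move=> A_q; apply/existsP/contraT; rewrite negb_exists => /forallP noA.
have: (\prod_(a : F) (A - a%:M) \is a GRing.unit)%R.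
  apply: rpred_prod => a _; have := noA a; rewrite negbK kermx_eq0 row_free_unit.
  exact.
rewrite (_ : (\prod_a _)%R = horner_mx A (\prod_(a : F) ('X - a%:P)%R)).
  by rewrite -finField_genPoly rmorphB rmorphXn /= horner_mx_X A_q subrr unitr0.
rewrite rmorph_prod; apply: eq_bigr => a _.
by rewrite rmorphB /= horner_mx_X horner_mx_C.
Qed.

(** As a matrix over the field of [r] elements, [h] satisfies [h ^+ r = h], so it has an
    eigenvector. *)
Lemma abelem_norm_cycle (gT : finGroupType) (E : {group gT}) (r : nat) (h : gT) :
    r.-abelem E -> E :!=: 1 -> h \in 'N(E) -> (#[h] %| r.-1)%N ->
  exists2 v, v \in E^# & h \in 'N(<[v]>).
Proof.
move=> abelE ntE nEh dv_h.
have r_pr: prime r by case: (pgroup_pdiv (abelem_pgroup abelE) ntE).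
have nEH: <[h]> \subset 'N(E) by rewrite cycle_subG.
pose rG := abelem_repr abelE ntE nEH; have Hh := cycle_id h.
have [|a /eigenvalueP[v vA nz_v]] := finField_eigenvalue (A := rG h).
  rewrite card_Fp // -(repr_mxX rG) //; congr (rG _).
  rewrite -(prednK (prime_gt0 r_pr)) expgS (eqP (_ : h ^+ r.-1 == 1)) ?mulg1 //.
  by rewrite -order_dvdn.
exists (rVabelem abelE ntE v).
  rewrite 2!inE mem_rVabelem andbT; apply: contraNneq nz_v => v1.
  by apply/eqP; apply: (@rVabelem_inj _ _ _ abelE ntE); rewrite v1 rVabelem0.
have Jv := rVabelemJ abelE ntE nEH v Hh; rewrite -/rG vA rVabelemZ in Jv.
by rewrite inE -cycleJ -Jv cycle_subG mem_cycle.
Qed.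

(** A minimal [Z]-invariant subgroup [E] of [K] is an irreducible [Z]-module, faithful by
    semiregularity, and an abelian group with a faithful irreducible module is cyclic. *)
Lemma abelian_semiregular_cyclic (gT : finGroupType) (K Z : {group gT}) :
    solvable K -> K :!=: 1 -> Z \subset 'N(K) -> abelian Z -> semiregular K Z ->
  cyclic Z.
Proof.
move=> solK ntK nKZ abZ regKZ.
have [E minE sEK] := minnormal_exists ntK nKZ.
have [nEZ ntE abelE] := minnormal_solvable minE sEK solK.
have [r r_pr abelEr] := is_abelemP abelE.
have ffulZ: 'C_Z(E) = 1.
  apply: cent_semiregular (semiregular_sym regKZ) sEK ntE.
apply: (mx_faithful_irr_abelian_cyclic (rG := abelem_repr abelEr ntE nEZ)) => //.
  exact: abelem_mx_faithful.
exact/abelem_mx_irrP.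
Qed.

(** Equal commutators put [g * g'^-1] in the centraliser of [b], which is trivial in [Q]; counting
    then turns injectivity into surjectivity. *)
Lemma semiregular_comm_imset (gT : finGroupType) (Q P : {group gT}) b :
  P \subset 'N(Q) -> semiregular Q P -> b \in P^# ->
  {in Q &, injective (commg b)} /\ [set [~ b, g] | g in Q] = Q.
Proof.
move=> nQP regQ P1b; have [ntb Pb] := setD1P P1b.
have inj: {in Q &, injective (commg b)}.
  move=> g g' Qg Qg'; rewrite !commgEl => eq_bg.
  have {eq_bg} := canLR (conjgK _) (mulgI _ _ _ eq_bg); rewrite -conjgM => bgg'.
  apply/eqP; rewrite eq_mulgV1 -in_set1 -[[set 1]](regQ b P1b) inE groupMl //.
  by rewrite groupV Qg' cent1C; apply/cent1P/commgP/conjg_fixP.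
split=> //; apply/eqP; rewrite eqEcard card_in_imset // leqnn andbT.
apply/subsetP=> _ /imsetP[g Qg ->]; rewrite commgEr groupM // memJ_norm ?groupV //.
exact: (subsetP nQP).
Qed.

(* The sum of [v ^ (b ^ g)] over [g] in [Q] and [b] in [P] vanishes, because each
   conjugate of [P] has no fixed point on [V].  The terms with [b = 1] contribute
   [v ^+ #|Q|]; for [b != 1], [g |-> [~ b, g]] permutes [Q], so that the terms add
   up to the [Q]-norm of [v ^ b].  Hence [v ^+ #|Q|] is fixed by [Q]. *)
Lemma abelian_Frobenius_cent (gT : finGroupType) (V Q P : {group gT}) :
    abelian V -> Q \subset 'N(V) -> P \subset 'N(V) -> P \subset 'N(Q) ->
    semiregular Q P -> coprime #|V| #|Q| -> 'C_V(P) = 1 ->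
  Q \subset 'C(V).
Proof.
move=> abV nVQ nVP nQP regQ coVQ cVP1.
have sum_fix (A : {group gT}) (u : fmod_of abV) x : A \subset 'N(V) -> x \in A ->
    (actr (\sum_(a in A) actr u a) x = \sum_(a in A) actr u a)%R.
  move=> nVA Ax; rewrite actr_sum [RHS](reindex_inj (mulIg x)).
  apply: eq_big => [a | a Aa]; first by rewrite groupMr.
  by rewrite actrM // (subsetP nVA).
rewrite centsC; apply/subsetP=> v Vv; apply/centP=> x Qx.
pose u := fmod abV v.
have sumP (w : fmod_of abV) : (\sum_(b in P) actr w b = 0)%R.
  apply: val_inj; apply/set1gP; rewrite /= -cVP1 inE fmodP.
  apply/centP=> b Pb; apply/commgP/conjg_fixP.
  by rewrite -fmvalJ ?(subsetP nVP) // sum_fix.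
have: (\sum_(g in Q) \sum_(b in P) actr u (b ^ g) = 0)%R.
  apply: big1 => g Qg; have nVg := subsetP nVQ g Qg.
  transitivity (actr (\sum_(b in P) actr (actr u g^-1) b) g)%R; last first.
    by rewrite sumP act0r.
  rewrite actr_sum.
  apply: eq_bigr => b Pb; have nVb := subsetP nVP b Pb.
  by rewrite -!actrM ?groupM ?groupV // conjgE mulgA.
rewrite exchange_big (bigD1 1) //=.
rewrite (eq_bigr (fun _ => u)) => [|g _]; last by rewrite conj1g actr1.
rewrite sumr_const => /eqP; rewrite addr_eq0 => /eqP sumQ.
have fixQ : (actr (u *+ #|Q|) x = u *+ #|Q|)%R.
  rewrite sumQ actNr actr_sum; congr (- _)%R; apply: eq_bigr => b /andP[Pb ntb].
  have P1b : b \in P^# by rewrite !inE ntb.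
  have [inj imQ] := semiregular_comm_imset nQP regQ P1b.
  suffices ->: (\sum_(g in Q) actr u (b ^ g) = \sum_(g in Q) actr (actr u b) g)%R.
    exact: sum_fix.
  rewrite -[in RHS]imQ big_imset //; apply: eq_bigr => g Qg.
  have Rg: [~ b, g] \in Q by rewrite -imQ imset_f.
  by rewrite -actrM ?(subsetP nVP b) ?(subsetP nVQ _ Rg) // mulKVg.
have: val (u *+ #|Q|)%R ^ x = val (u *+ #|Q|)%R.
  by rewrite -fmvalJ ?(subsetP nVQ) // fixQ.
rewrite [val _]fmvalZ [val u]fmodK // => /conjg_fixP/commgP.
(* As [#|Q|] is coprime to [#|V|], [v] is a power of [v ^+ #|Q|]. *)
move=> cvx; rewrite -(expgK coVQ Vv).
exact/commute_sym/commuteX/commute_sym.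
Qed.

(** [Q] centralises the derived subgroup of [V] by induction and the abelianisation of [V] by the
    abelian case; by coprimality it centralises [V]. *)
Lemma solvable_Frobenius_cent (gT : finGroupType) (V Q P : {group gT}) :
    solvable V -> Q \subset 'N(V) -> P \subset 'N(V) -> P \subset 'N(Q) ->
    semiregular Q P -> coprime #|V| #|Q| -> coprime #|V| #|P| -> 'C_V(P) = 1 ->
  Q \subset 'C(V).
Proof.
have [n] := ubnP #|V|; elim: n => // n IHn in V *; rewrite ltnS => leVn.
move=> solV nVQ nVP nQP regQ coVQ coVP cVP1.
have [->|ntV] := eqVneq (V : {set gT}) 1; first by rewrite centsC sub1G.
have sV'V := der_sub 1 V; have nV'V := der_norm 1 V.
have nV'Q := char_norm_trans (der_char 1 V) nVQ.
have nV'P := char_norm_trans (der_char 1 V) nVP.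
have solV' := solvableS sV'V solV.
have cV'Q: Q \subset 'C(V^`(1)).
  apply: IHn; rewrite ?(coprimeSg sV'V) //.
    by apply: leq_trans leVn; apply/proper_card/(sol_der1_proper solV).
  by apply/trivgP; rewrite -cVP1 setSI.
have: Q / V^`(1) \subset 'C(V / V^`(1)).
  apply: (@abelian_Frobenius_cent _ _ _ (P / V^`(1))%G) => //=;
    rewrite ?quotient_norms //.
  - exact: sub_der1_abelian.
  - move=> xb /setD1P[ntxb /morphimP[x nx Px Dx]]; rewrite /= in Dx.
    (* Semiregularity passes to the quotient, because [<[x]>] acts coprimely on the derived subgroup
       of [V]. *)
    have ntx : x != 1 by apply: contraNneq ntxb => x1; rewrite Dx x1 morph1.
    have sxP : <[x]> \subset P by rewrite cycle_subG.
    rewrite -cent_cycle Dx -quotient_cycle // -coprime_norm_quotient_cent //=.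
    - by rewrite cent_cycle regQ ?quotient1 // !inE ntx.
    - exact: subset_trans sxP nQP.
    - exact: subset_trans sxP nV'P.
    - exact: coprimegS sxP (coprimeSg sV'V coVP).
  - by rewrite coprime_morph.
  by rewrite -coprime_quotient_cent // cVP1 quotient1.
rewrite centsC => /setIidPl; rewrite -coprime_quotient_cent // => cVQ.
have sV'C: V^`(1) \subset 'C_V(Q) by rewrite subsetI sV'V centsC.
have eqC: 'C_V(Q) = V.
  have nsV'C := normalS sV'C (subsetIl _ _) (der_normal 1 V).
  by rewrite -(quotientGK nsV'C) cVQ quotientGK ?der_normal.
by rewrite centsC -eqC subsetIr.
Qed.

(** * Arcs, universal vertices and mutual reachability *)

Lemma norm_toE (gT : finGroupType) (x y : gT) : norm_to x y = (y \in 'N(<[x]>)).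
Proof.
rewrite /norm_to /= /normal cycle_subG mem_gen ?set21 //= gen_subG subUset !sub1set.
by rewrite (subsetP (normG _)) ?cycle_id.
Qed.

Lemma norm_cycleS (gT : finGroupType) (x x' y : gT) :
  x' \in <[x]> -> y \in 'N(<[x]>) -> y \in 'N(<[x']>).
Proof.
move=> xx'; rewrite -!cycle_subG; apply: char_norm_trans.
by apply: cycle_subgroup_char; rewrite cycle_subG.
Qed.

(* If a prime-order power [x] of a universal vertex did not commute with [y], then
   [[~ x, y]] would be a nontrivial element of [<[x]>] lying in [<[y]>], which
   forces [x] to be a power of [y]. *)
Lemma Univ_trivial (gT : finGroupType) (G : {group gT}) :
  'Z(G) = 1 -> Univ G = 1.
Proof.
move=> trivZ; apply/eqP; rewrite eqEsubset sub1set inE group1 /=.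
apply/andP; split; last first.
  apply/forall_inP => y Gy; rewrite /norm_both /= !norm_toE cycle1 norm1 inE.
  by rewrite group1.
apply/subsetP => x0 /setIdP[Gx0 /forall_inP univ]; rewrite inE.
apply: contraTT isT => ntx0.
have [x xx0 x_pr] := prime_order_power ntx0.
have Gx : x \in G by apply: subsetP xx0; rewrite cycle_subG.
have ntx : x != 1 by rewrite -order_gt1 prime_gt1.
suffices: x \in 'Z(G) by rewrite trivZ inE (negPf ntx).
rewrite inE Gx; apply/centP => y Gy; apply/commgP/contraT => ntxy.
have := univ y Gy; rewrite /norm_both /= !norm_toE => /andP[nx0y nyx0].
have nxy := norm_cycleS xx0 nx0y.
have nyx : x \in 'N(<[y]>) by apply: subsetP xx0; rewrite cycle_subG.
have Rx : [~ x, y] \in <[x]> by rewrite commgEl groupM ?groupV ?memJ_norm ?cycle_id.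
have Ry : [~ x, y] \in <[y]>.
  by rewrite commgEr groupM ?cycle_id // memJ_norm ?groupV ?cycle_id.
have [|tixy] := prime_subgroupVti <[y]> x_pr.
  rewrite cycle_subG => /cycleP[i xE]; case/negP: ntxy; rewrite xE.
  by apply/commgP/commute_sym/commuteX.
by case/negP: ntxy; rewrite -in_set1 -[[set 1]]tixy inE Rx Ry.
Qed.

(** Loops are kept, which is harmless for [connect]. When ['Z(G) = 1], the set [G^#] is the vertex
    set of [Delta_norm G]. *)
Definition norm_arc (gT : finGroupType) (G : {group gT}) : rel gT :=
  [rel x y | [&& x \in G^#, y \in G^# & y \in 'N(<[x]>)]].

Lemma strongly_connectedP (gT : finGroupType) (G : {group gT}) :
  'Z(G) = 1 ->
  strongly_connected (Delta_norm G) <->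
  {in G^# &, forall x y, connect (norm_arc G) x y}.
Proof.
move=> trivZ.
have vE : vertices (Delta_norm G) = G^#.
  by rewrite /= (Univ_trivial trivZ) setIDA setIid.
have eE x y : arcs_in (Delta_norm G) x y = (x != y) && norm_arc G x y.
  by rewrite /arcs_in -[LHS]/[&& _, _, _ & _] vE norm_toE /=; do !bool_congr.
suffices cE : connect (arcs_in (Delta_norm G)) =2 connect (norm_arc G).
  rewrite /strongly_connected vE.
  by split=> c x y Gx Gy; have := c x y Gx Gy; rewrite cE.
move=> x y; apply/idP/idP; apply: connect_sub => {}x {}y.
  by rewrite eE => /andP[_ /connect1].
have [-> // | nxy] := eqVneq x y; rewrite ?connect0 // => xy.
by apply: connect1; rewrite eE nxy.
Qed.

(** On vertices, this is the relation of lying in the same strong component. *)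
Definition linked (gT : finGroupType) (G : {group gT}) : rel gT :=
  [rel x y | connect (norm_arc G) x y && connect (norm_arc G) y x].

Lemma linked_sym (gT : finGroupType) (G : {group gT}) : symmetric (linked G).
Proof. by move=> x y; rewrite /linked /= andbC. Qed.

Lemma linked_trans (gT : finGroupType) (G : {group gT}) : transitive (linked G).
Proof.
move=> y x z /andP[xy yx] /andP[yz zy]; apply/andP.
by split; [apply: connect_trans xy yz | apply: connect_trans zy yx].
Qed.

Lemma linked_commute (gT : finGroupType) (G : {group gT}) x y :
  x \in G^# -> y \in G^# -> commute x y -> linked G x y.
Proof.
have c u v : u \in G^# -> v \in G^# -> commute u v -> connect (norm_arc G) u v.
  move=> Gu Gv cuv; apply: connect1; rewrite /norm_arc /= Gu Gv /=.
  rewrite (subsetP (cent_sub _)) // cent_cycle; exact/cent1P.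
by move=> Gx Gy cxy; rewrite /linked /= !c.
Qed.

Lemma linked_power (gT : finGroupType) (G : {group gT}) x y :
  x \in G^# -> y \in <[x]> -> y != 1 -> linked G x y.
Proof.
move=> G1x xy nty; have [ntx Gx] := setD1P G1x.
apply: linked_commute => //.
  by rewrite !inE nty (subsetP _ y xy) // cycle_subG.
by case/cycleP: xy => i ->; apply: commuteX.
Qed.

Lemma norm_arcJ (gT : finGroupType) (G : {group gT}) g x y :
  g \in G -> norm_arc G (x ^ g) (y ^ g) = norm_arc G x y.
Proof.
move=> Gg; rewrite /norm_arc /= cycleJ normJ memJ_conjg.
by rewrite !in_setD1 !groupJr // !conjg_eq1.
Qed.

Lemma linkedJ (gT : finGroupType) (G : {group gT}) g x y :
  g \in G -> linked G x y -> linked G (x ^ g) (y ^ g).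
Proof.
move=> Gg.
have c u v : connect (norm_arc G) u v -> connect (norm_arc G) (u ^ g) (v ^ g).
  case/connectP => s; elim: s u => [u _ -> | w s IHs u /= /andP[uw ws] vE].
    exact: connect0.
  apply: connect_trans (IHs w ws vE); apply: connect1; by rewrite norm_arcJ.
by case/andP=> xy yx; rewrite /linked /= !c.
Qed.

Lemma linked_nilpotent (gT : finGroupType) (G N : {group gT}) x y :
  nilpotent N -> N \subset G -> x \in N^# -> y \in N^# -> linked G x y.
Proof.
move=> nilN sNG N1x N1y; have [ntx Nx] := setD1P N1x; have [nty Ny] := setD1P N1y.
have ntN : N :!=: 1 by apply/trivgPn; exists x.
have ntZ : 'Z(N) != 1 by rewrite (center_nil_eq1 nilN).
have [z /setIP[Nz /centP cNz] ntz] := trivgPn _ ntZ.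
have in1 u : u \in N -> u != 1 -> u \in G^#.
  by move=> Nu ntu; rewrite !inE ntu (subsetP sNG).
apply: (@linked_trans _ _ z); apply: linked_commute; rewrite ?in1 //.
  exact/commute_sym/cNz.
exact: cNz.
Qed.

(** * Disconnectedness of Frobenius and 2-Frobenius groups *)

Lemma connect_stable (T : finType) (e : rel T) (S : {pred T}) x y :
  (forall u v, e u v -> u \in S -> v \in S) -> connect e x y -> x \in S -> y \in S.
Proof.
move=> eS /connectP[s]; elim: s x => [x _ -> // | z s IHs x /= /andP[xz zs] yE Sx].
exact: IHs zs yE (eS _ _ xz Sx).
Qed.

(** If [v] normalises [<[u]>] with [u] in [H^#], then [u ^ v] lies in [H], so [v] lies in [H] by the
    TI property. Thus [H^#] is closed under arcs, while [H] is proper. *)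
Lemma Frobenius_disconnected (gT : finGroupType) (G : {group gT}) :
  [Frobenius G] -> ~ {in G^# &, forall x y, connect (norm_arc G) x y}.
Proof.
case/existsP => H /andP[neqHG /normedTI_memJ_P[ntH sHG tiH]] conn.
have [h H1h] := set0Pn _ ntH; have [nth Hh] := setD1P H1h.
have /properP[_ [y Gy H'y]] : H \proper G by rewrite properEneq neqHG.
case/negP: (H'y).
have G1h : h \in G^# by rewrite !inE nth (subsetP sHG).
have nty : y != 1 by apply: contraNneq H'y => ->.
suffices: y \in H^# by case/setD1P.
apply: connect_stable (conn h y G1h _) H1h; last by rewrite !inE nty.
move=> u v /and3P[_ /setD1P[ntv Gv] nuv] H1u; have [ntu Hu] := setD1P H1u.
rewrite !inE ntv -(tiH u) // !inE conjg_eq1 ntu /=.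
by apply: (subsetP (_ : <[u]> \subset H)); rewrite ?cycle_subG ?memJ_norm ?cycle_id.
Qed.

(** Having prime order and not commuting with [k], [z] generates a group that embeds in [Aut <[k]>],
    of order [#[k] - 1]. *)
Lemma norm_cycle_prime_dvd (gT : finGroupType) (k z : gT) :
  prime #[k] -> prime #[z] -> z \in 'N(<[k]>) -> ~ commute k z -> (#[z] %| #[k] - 1)%N.
Proof.
move=> k_pr z_pr nkz nckz; rewrite subn1 -totient_prime // -card_Aut_cycle.
have nkZ : <[z]> \subset 'N(<[k]>) by rewrite cycle_subG.
have tiC : <[z]> :&: 'C(<[k]>) = 1.
  rewrite setIC; have [|//] := prime_subgroupVti 'C(<[k]>)%G z_pr.
  by rewrite cycle_subG /= cent_cycle => /cent1P/commute_sym.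
have <-: #|conj_aut <[k]>%G @* <[z]>| = #[z].
  by rewrite card_morphim (setIidPr nkZ) ker_conj_aut -indexgI tiC indexg1.
exact/cardSg/Aut_conj_aut.
Qed.

Lemma two_Frobenius_disconnected (gT : finGroupType) (G K H L : {group gT}) :
    two_Frobenius_with G K H L ->
    (forall p r : nat, p \in \pi(H) -> r \in \pi(K) -> ~~ (p %| r - 1)%N) ->
  ~ {in G^# &, forall x y, connect (norm_arc G) x y}.
Proof.
case=> [[nsKG nsKHG] [sKL sLG] frobKH frobGK] ndv conn.
have nKH : H \subset 'N(K).
  apply: subset_trans (mulG_subr K H) _.
  exact: subset_trans (normal_sub nsKHG) (normal_norm nsKG).
rewrite -(norm_joinEr nKH) in nsKHG frobKH frobGK.
have [defKH ntK ntH _ _] := Frobenius_context frobKH.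
have [defGK ntKHK ntLK _ _] := Frobenius_context frobGK.
have nsKKH : K <| K <*> H by rewrite normalYl.
pose pi := \pi(H).
have coKH := Frobenius_coprime frobKH.
have piK : pi^'.-group K.
  by rewrite /pgroup -coprime_pi' ?cardG_gt0 1?coprime_sym.
have piN : pi.-group (K <*> H / K).
  rewrite quotientYidl //; apply: morphim_pgroup; exact: pgroup_pi.
have oN : #|K <*> H / K| = #|H|.
  by rewrite quotientYidl // -(card_isog (quotient_isog nKH _)) //; case/sdprodP: defKH.
have hallN : pi.-Hall(G / K) (K <*> H / K).
  by have := Hall_pi (Frobenius_ker_Hall frobGK); rewrite /= oN.
have fixK z k : z \in K <*> H -> z \notin K -> k \in K^# -> ~ commute k z.
  move=> KHz K'z K1k ckz; case/negP: K'z.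
  have := subsetP (Frobenius_cent1_ker frobKH K1k) z; rewrite inE KHz; apply.
  exact/cent1P.
have stable u v : norm_arc G u v -> pi^'.-elt u -> pi^'.-elt v.
  case/and3P => /setD1P[ntu Gu] /setD1P[ntv Gv] nuv pi'u; apply: contraT => npi'v.
  have [p p_pr [pi_p pv]] : exists2 p, prime p & p \in pi /\ (p %| #[v])%N.
    have /allPn[p] : ~~ all [in pi^'] (primes #[v]).
      apply: contraNN npi'v => /allP p'v; apply/pgroupP => q q_pr qv.
      by apply: p'v; rewrite mem_primes q_pr order_gt0.
    rewrite mem_primes negbK => /and3P[p_pr _ pv] pi_p.
    by exists p.
  (* The target [v] is replaced by a power [z] of prime order [p] in [pi], which still normalises
     [<[u]>]. *)
  have [z zv oz] := Cauchy p_pr pv.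
  have nuz : z \in 'N(<[u]>) by apply: subsetP zv; rewrite cycle_subG.
  have Gz : z \in G by apply: subsetP zv; rewrite cycle_subG.
  have piz : pi.-elt z by rewrite /p_elt oz pnatE.
  have nKz : z \in 'N(K) by rewrite (subsetP (normal_norm nsKG)).
  have Nz : coset K z \in K <*> H / K.
    by rewrite (mem_normal_Hall hallN) ?quotient_normal ?mem_quotient ?morph_p_elt.
  have KHz : z \in K <*> H.
    by rewrite -(quotientGK nsKKH) mem_morphpre.
  have K'z : z \notin K.
    apply: contraTN (prime_gt1 p_pr) => Kz.
    by rewrite -oz (pnat_1 piz (mem_p_elt piK Kz)).
  (* If [u] is in [K], then [z] normalises but does not centralise a prime-order power [k] of [u],
     against the arithmetic condition. *)
  have [Ku | K'u] := boolP (u \in K).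
    have [r r_pr ru] : exists2 r, prime r & (r %| #[u])%N.
      by exists (pdiv #[u]); rewrite ?pdiv_dvd ?pdiv_prime ?order_gt1.
    have [k ku ok] := Cauchy r_pr ru.
    have Kk : k \in K by apply: subsetP ku; rewrite cycle_subG.
    have ntk : k != 1 by rewrite -order_gt1 ok prime_gt1.
    have piKr : r \in \pi(K).
      by rewrite mem_primes r_pr cardG_gt0 -ok order_dvdG.
    case/negP: (ndv p r pi_p piKr); rewrite -ok -oz.
    apply: norm_cycle_prime_dvd; rewrite ?ok ?oz //.
      exact: norm_cycleS ku nuz.
    by apply: fixK => //; rewrite !inE ntk.
  have nKu : u \in 'N(K) by rewrite (subsetP (normal_norm nsKG)).
  have nuN : <[coset K u]> \subset 'N(K <*> H / K).
    by rewrite cycle_subG (subsetP (quotient_norms _ (normal_norm nsKHG))) ?mem_quotient.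
  have pi'ub : pi^'.-elt (coset K u) by rewrite morph_p_elt.
  have tiN : <[coset K u]> :&: (K <*> H / K) = 1.
    by rewrite setIC (coprime_TIg (pnat_coprime piN pi'ub)).
  have nuzb : coset K z \in 'N(<[coset K u]>).
    rewrite -quotient_cycle // (subsetP (quotient_norm _ _)) //.
    exact: mem_quotient.
  (* The commutator lies both in [<[coset K u]>], a [pi^']-group, and in the normal [pi]-subgroup
     [K <*> H / K]. *)
  have cuz : commute (coset K u) (coset K z).
    apply/commgP; rewrite -in_set1 -[[set 1]]tiN inE; apply/andP; split.
      by rewrite commgEl groupM ?groupV ?memJ_norm ?cycle_id.
    rewrite commgEr groupM // memJ_norm ?groupV //.
    by rewrite -cycle_subG.
  have : coset K u \in K <*> H / K.
    apply: (subsetP (Frobenius_cent1_ker frobGK (x := coset K z) _)).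
      rewrite !inE Nz andbT.
      by apply: contraNneq K'z => /(coset_idr nKz).
    by rewrite inE mem_quotient //; apply/cent1P/commute_sym.
  rewrite (mem_normal_Hall hallN) ?quotient_normal ?mem_quotient //.
  move=> piub; case/negP: K'u; apply: (coset_idr nKu); apply/eqP.
  by rewrite -order_eq1 (pnat_1 piub pi'ub).
have [k Kk ntk] := trivgPn _ ntK.
have [h Hh nth] := trivgPn _ ntH.
have G1 x : x \in K <*> H -> x != 1 -> x \in G^#.
  by move=> KHx ntx; rewrite !inE ntx (subsetP (normal_sub nsKHG)).
have ckh : connect (norm_arc G) k h.
  by apply: conn; apply: G1; rewrite // mem_gen // inE ?Kk ?Hh ?orbT.
have pi'h : pi^'.-elt h.
  exact: (connect_stable (S := [pred x | pi^'.-elt x]) stable ckh (mem_p_elt piK Kk)).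
case/negP: nth; rewrite -order_eq1.
by rewrite (pnat_1 (mem_p_elt (pgroup_pi H) Hh) pi'h).
Qed.

(** * The Fitting subgroup and a Sylow supplement *)

Lemma prime_semiregular (gT : finGroupType) (K : {group gT}) x :
  prime #[x] -> 'C_K[x] = 1 -> semiregular K <[x]>.
Proof.
move=> x_pr cKx; apply: semiprime_regular; last by rewrite cent_cycle.
move=> y /setD1P[nty xy]; congr (_ :&: _); rewrite -cent_cycle; congr 'C(_).
apply/eqP; rewrite eqEsubset cycle_subG xy /=.
have [//|tixy] := prime_subgroupVti <[y]>%G x_pr.
case/negP: nty; rewrite -in_set1 -[[set 1]]tixy inE xy cycle_id //.
Qed.

Lemma linked_Fitting (gT : finGroupType) (G : {group gT}) x f :
  x \in G^# -> 'C_('F(G))[x] != 1 -> f \in 'F(G)^# -> linked G x f.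
Proof.
move=> G1x /trivgPn[k /setIP[Fk cxk] ntk] F1f.
have F1k : k \in 'F(G)^# by rewrite !inE ntk.
apply: linked_trans (linked_nilpotent (Fitting_nil G) (Fitting_sub G) F1k F1f).
apply: linked_commute => //; last exact/commute_sym/cent1P.
by rewrite !inE ntk (subsetP (Fitting_sub G)).
Qed.

(** A minimal normal subgroup of [G / 'F(G)] is a [q]-group; [Q] is a Sylow [q]-subgroup of its
    preimage, and the Frattini argument gives the factorisation. *)
Lemma Fitting_Sylow_supplement (gT : finGroupType) (G : {group gT}) :
    solvable G -> ~~ nilpotent G ->
  exists q, exists Q : {group gT},
    [/\ q.-Sylow('F(G) <*> Q) Q, 'F(G) <*> Q <| G, ~~ (Q \subset 'F(G))
      & 'F(G) * 'N_G(Q) = G].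
Proof.
move=> solG nnilG; have nsFG := Fitting_normal G; have [sFG nFG] := andP nsFG.
have ntGF : G / 'F(G) != 1.
  apply: contraNneq nnilG => /eqP; rewrite -subG1 quotient_sub1 // => sGF.
  exact: nilpotentS sGF (Fitting_nil G).
have [W minW sWG] := minnormal_exists ntGF (normG _).
have [nWG ntW] := minnormal_solvable minW sWG (quotient_sol _ solG).
case/is_abelemP => q q_pr abelW.
have nsWG : W <| G / 'F(G) by rewrite /normal sWG.
have [V /= defW sFV nsVG] := inv_quotientN nsFG nsWG.
have qV : q.-group (V / 'F(G)) by rewrite -defW (abelem_pgroup abelW).
have [Q sylQ] := Sylow_exists q V.
have [sQV sVG] := (pHall_sub sylQ, normal_sub nsVG).
have nFV := subset_trans sVG nFG; have nFQ := subset_trans sQV nFV.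
have defV : 'F(G) <*> Q = V.
  have QV := pHall_id (quotient_pHall nFQ sylQ) qV.
  rewrite norm_joinEr //.
  by rewrite -quotientK // QV quotientGK // (normalS sFV sVG).
exists q, Q; rewrite defV; split=> //.
  apply: contra ntW => sQF; rewrite defW -subG1 quotient_sub1 //.
  by rewrite -defV join_subG subxx.
have := Frattini_arg nsVG sylQ; rewrite -{1}defV norm_joinEr // -mulgA.
rewrite (mulSGid (_ : Q \subset _)) // subsetI normG andbT.
exact: subset_trans sQV sVG.
Qed.

(** As [x] has no fixed point on ['F(G)], its order [p] is coprime to [#|'F(G)|], so a Sylow
    [p]-subgroup of ['N_G(Q)] is Sylow in [G] and contains a conjugate [y] of [x]. Were [y]
    fixed-point-free on [Q], then [Q] would centralise the [q^']-part [R] of ['F(G)], and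
    ['F(G) <*> Q], a central product of [R] and [Q], would be nilpotent and normal, hence inside
    ['F(G)]. *)
Lemma prime_elt_Sylow_cent (gT : finGroupType) (G Q : {group gT}) q x :
    solvable G -> q.-Sylow('F(G) <*> Q) Q -> 'F(G) <*> Q <| G ->
    ~~ (Q \subset 'F(G)) -> 'F(G) * 'N_G(Q) = G ->
    x \in G -> prime #[x] -> 'C_('F(G))[x] = 1 ->
  exists2 g, g \in G & 'C_Q[x ^ g] != 1.
Proof.
move=> solG sylQ nsVG nsQF defG Gx x_pr cFx; set p := #[x] in x_pr.
have nsFG := Fitting_normal G; have [sFG nFG] := andP nsFG.
have nilF := Fitting_nil G; have qQ := pHall_pgroup sylQ.
have sQG : Q \subset G := subset_trans (joing_subr _ _) (normal_sub nsVG).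
pose M := 'N_G(Q)%G; have sMG : M \subset G := subsetIl _ _.
have [S sylS] := Sylow_exists p M.
have p'F : p^'.-nat #|'F(G)|.
  have nFx : <[x]> \subset 'N('F(G)) by rewrite cycle_subG (subsetP nFG).
  have := regular_norm_coprime nFx (prime_semiregular x_pr cFx).
  by rewrite -orderE -/p coprime_sym prime_coprime // p'natE.
have sylGS : p.-Sylow(G) S.
  have p'M : p^'.-nat #|G : M|.
    have defMF : M * 'F(G) = G by rewrite normC // (subset_trans sMG).
    rewrite -{1}defMF indexMg; apply: pnat_dvd p'F.
    exact: dvdn_indexg.
  rewrite /pHall (subset_trans (pHall_sub sylS) sMG) (pHall_pgroup sylS) /=.
  by rewrite -(Lagrange_index sMG (pHall_sub sylS)) pnatM p'M; case/and3P: sylS.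
have px : p.-group <[x]> by rewrite /pgroup -orderE -/p pnat_id.
have sxG : <[x]> \subset G by rewrite cycle_subG.
have [g Gg] := Sylow_Jsub sylGS sxG px.
rewrite -cycleJ cycle_subG => Sxg; exists g => //; set y := x ^ g in Sxg *.
have [Gy nQy] : y \in G /\ y \in 'N(Q).
  by apply/setIP; apply: subsetP Sxg; apply: pHall_sub sylS.
apply/negP => /eqP cQy.
have y_pr : prime #[y] by rewrite orderJ.
have cFy : 'C_('F(G))[y] = 1.
  have <- : 'F(G) :^ g = 'F(G) by rewrite (normsP nFG).
  by rewrite cent1J -conjIg cFx conjs1g.
pose R := 'O_q^'('F(G)).
have chR : R \char 'F(G) := pcore_char _ _.
have nRG : G \subset 'N(R) := char_norm_trans chR nFG.
have nRy : <[y]> \subset 'N(R) by rewrite cycle_subG (subsetP nRG).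
have cRy : 'C_R[y] = 1 by apply/trivgP; rewrite -cFy setSI ?pcore_sub.
have cRQ : Q \subset 'C(R).
  apply: (@solvable_Frobenius_cent _ _ _ <[y]>%G).
  - exact: solvableS (pcore_sub _ _) (nilpotent_sol nilF).
  - exact: subset_trans sQG nRG.
  - by [].
  - by rewrite cycle_subG.
  - exact: prime_semiregular.
  - by rewrite coprime_sym (pnat_coprime qQ (pcore_pgroup _ _)).
  - exact: regular_norm_coprime nRy (prime_semiregular y_pr cRy).
  - by rewrite cent_cycle.
have sFqQ : 'O_q('F(G)) \subset Q.
  apply: subset_trans (pcore_sub_Hall sylQ).
  apply: pcore_max (pcore_pgroup _ _) _.
  apply: char_normal_trans (pcore_char _ _) _.
  by rewrite normalYl (subset_trans sQG).
have defV : R \* Q = 'F(G) <*> Q.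
  rewrite cprodEY //.
  apply/eqP; rewrite eqEsubset !join_subG !joing_subr.
  rewrite (subset_trans (pcore_sub _ _)) ?joing_subl //=.
  rewrite -{1}(dprodW (nilpotent_pcoreC q nilF)) mul_subG ?joing_subl //.
  exact: subset_trans sFqQ (joing_subr _ _).
case/negP: nsQF; apply: subset_trans (joing_subr 'F(G) Q) _; apply: Fitting_max => //.
rewrite (cprod_nil defV) (nilpotentS (pcore_sub _ _) nilF).
exact: pgroup_nil qQ.
Qed.

Lemma connected_of_linked_Sylow (gT : finGroupType) (G Q : {group gT}) q f y :
    solvable G -> q.-Sylow('F(G) <*> Q) Q -> 'F(G) <*> Q <| G ->
    ~~ (Q \subset 'F(G)) -> 'F(G) * 'N_G(Q) = G ->
    f \in 'F(G)^# -> y \in Q^# -> linked G y f ->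
  {in G^# &, forall u v, connect (norm_arc G) u v}.
Proof.
move=> solG sylQ nsVG nsQF defG F1f Q1y linkyf.
have sQG : Q \subset G := subset_trans (joing_subr _ _) (normal_sub nsVG).
suffices linkf u : u \in G^# -> linked G u f.
  move=> u v G1u G1v; have /andP[uf _] := linkf u G1u; have /andP[_ fv] := linkf v G1v.
  exact: connect_trans uf fv.
move=> G1u; have [ntu Gu] := setD1P G1u.
have [x ux x_pr] := prime_order_power ntu.
have ntx : x != 1 by rewrite -order_gt1 prime_gt1.
have Gx : x \in G by apply: subsetP ux; rewrite cycle_subG.
have G1x : x \in G^# by rewrite !inE ntx.
apply: linked_trans (linked_power G1u ux ntx) _.
have [cFx | ntcFx] := eqVneq 'C_('F(G))[x] 1; last exact: linked_Fitting.
have [g Gg] := prime_elt_Sylow_cent solG sylQ nsVG nsQF defG Gx x_pr cFx.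
case/trivgPn => z /setIP[Qz czx] ntz.
have Q1z : z \in Q^# by rewrite !inE ntz.
have linkxf : linked G (x ^ g) f.
  apply: (@linked_trans _ _ z).
    apply: linked_commute; last exact/commute_sym/cent1P.
      by rewrite !inE conjg_eq1 ntx groupJ.
    by rewrite !inE ntz (subsetP sQG).
  apply: linked_trans linkyf.
  exact: linked_nilpotent (pgroup_nil (pHall_pgroup sylQ)) sQG Q1z Q1y.
(* Conjugating back turns [f] into [f ^ g^-1], which is still in ['F(G)^#] and hence linked to
   [f]. *)
have Gg' : g^-1 \in G by rewrite groupV.
have := linkedJ Gg' linkxf; rewrite conjgK => linkxf'.
apply: linked_trans linkxf' _.
apply: linked_nilpotent (Fitting_nil G) (Fitting_sub G) _ (F1f).
rewrite -(memJ_conjg _ g) conjgKV.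
by rewrite conjD1g (normsP (normal_norm (Fitting_normal G)) g Gg).
Qed.

(** * Structure of a group with disconnected graph *)

(** Modulo the centraliser of [Z], [M] embeds in [Aut Z], which is abelian for cyclic [Z]. *)
Lemma der1_sub_cent_cyclic (gT : finGroupType) (M Z : {group gT}) :
  cyclic Z -> M \subset 'N(Z) -> M^`(1) \subset 'C(Z).
Proof.
move=> cycZ nZM; rewrite -ker_conj_aut ker_trivg_morphim morphim_der //.
rewrite (subset_trans (der_sub 1 M)) //= subG1.
apply/eqP/commG1P.
exact: abelianS (Aut_conj_aut _ _) (Aut_cyclic_abelian cycZ).
Qed.

Lemma Frobenius_quotient_disjoint (gT : finGroupType) (F M H L : {group gT}) :
    M \subset 'N(F) -> F :&: M = 1 -> [Frobenius M = H ><| L] ->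
  [Frobenius M / F = (H / F) ><| (L / F)].
Proof.
move=> nFM tiFM frobM; have [defM _ _ _ _] := Frobenius_context frobM.
have [/andP[sHM _] sLM _ _ _] := sdprod_context defM.
have injf : 'injm (restrm nFM (coset F)).
  by rewrite ker_restrm ker_coset setIC tiFM.
by have := injm_Frobenius (subxx M) injf frobM; rewrite !morphim_restrm !(setIidPr _).
Qed.

(* As [M^`(1)] meets [<[x]>] trivially, [x] is centralised by its normaliser in [M],
   which supplements [H] by the Frattini argument in [H <*> <[x]>]. *)
Lemma Frobenius_norm_cycle (gT : finGroupType) (M H : {group gT}) x :
    H \subset M -> M^`(1) \subset H -> H :!=: 1 -> x \in M -> prime #[x] ->
    'C_H[x] = 1 -> semiregular H 'C_M[x] -> 
  [Frobenius M = H ><| 'C_M[x]].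
Proof.
move=> sHM sM'H ntH Mx x_pr cHx regH.
have nsHM := sub_der1_normal sM'H sHM; have nHM := normal_norm nsHM.
have sxM : <[x]> \subset M by rewrite cycle_subG.
have nHx := subset_trans sxM nHM; have regHx := prime_semiregular x_pr cHx.
have coHx := regular_norm_coprime nHx regHx.
have tiHx := coprime_TIg coHx.
have sN : H <*> <[x]> \subset M by rewrite join_subG sHM.
have nsN : H <*> <[x]> <| M.
  exact: sub_der1_normal (subset_trans sM'H (joing_subl _ _)) sN.
have sylx : #[x].-Sylow(H <*> <[x]>) <[x]>.
  rewrite pHallE joing_subr /= norm_joinEr // coprime_cardMg // partnM ?cardG_gt0 //.
  rewrite -orderE part_p'nat ?mul1n ?part_pnat_id ?pnat_id //.
  by rewrite p'natE // -prime_coprime // coprime_sym.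
have cMx : 'N_M(<[x]>) = 'C_M[x].
  apply/eqP; rewrite -cent_cycle eqEsubset andbC setIS ?cent_sub //=.
  rewrite subsetI subsetIl /= (sameP commG1P trivgP) -tiHx subsetI.
  rewrite (subset_trans _ sM'H) /=; last by rewrite derg1 commgSS ?subsetIl.
  by rewrite commg_subr subsetIr.
have defM : H * 'C_M[x] = M.
  have /= := Frattini_arg nsN sylx; rewrite -cMx norm_joinEr // -mulgA.
  by rewrite (mulSGid (_ : <[x]> \subset _)) // subsetI sxM normG.
apply/Frobenius_semiregularP => //.
  rewrite sdprodE //; first exact: subset_trans (subsetIl _ _) nHM.
  by rewrite setIA (setIidPl sHM).
apply/trivgPn; exists x; last by rewrite -order_gt1 prime_gt1.
by rewrite inE Mx cent1id.
Qed.

Lemma disconnected_Frobenius (gT : finGroupType) (G : {group gT}) :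
    solvable G -> ~ {in G^# &, forall u v, connect (norm_arc G) u v} ->
    [Frobenius G] \/
    exists K H : {group gT},
      (exists L : {group gT}, two_Frobenius_with G K H L) /\
      (forall p r : nat, p \in \pi(H) -> r \in \pi(K) -> ~~ (p %| r - 1)%N).
Proof.
move=> solG nconn.
have nnilG : ~~ nilpotent G.
  apply/negP => nilG; apply: nconn => u v G1u G1v.
  by have /andP[] := linked_nilpotent nilG (subxx _) G1u G1v.
have [q [Q [sylQ nsVG nsQF defG]]] := Fitting_Sylow_supplement solG nnilG.
have sQG : Q \subset G := subset_trans (joing_subr _ _) (normal_sub nsVG).
pose F := ('F(G))%G; pose M := 'N_G(Q)%G.
have nsFG : F <| G := Fitting_normal G; have [sFG nFG] := andP nsFG.
have sMG : M \subset G := subsetIl _ _.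
have ntF : F :!=: 1.
  apply: contraNneq nnilG => F1; have := trivg_Fitting solG.
  by rewrite [X in X == _]F1 eqxx => /esym/eqP->; apply: nilpotent1.
have [f Ff ntf] := trivgPn _ ntF.
have F1f : f \in F^# by rewrite !inE ntf.
have ntQ : Q :!=: 1 by apply: contraNneq nsQF => ->; apply: sub1G.
have unlinkQ y : y \in Q^# -> ~ linked G y f.
  move=> Q1y lyf; apply: nconn.
  exact: connected_of_linked_Sylow solG sylQ nsVG nsQF defG F1f Q1y lyf.
have G1 (A : {group gT}) x : A \subset G -> x \in A^# -> x \in G^#.
  by move=> sAG; apply: subsetP; apply: setSD.
have unlink_reg (A : {group gT}) : A \subset G ->
    (forall y, y \in A^# -> ~ linked G y f) -> semiregular F A.
  move=> sAG unlinkA y A1y; apply/eqP/contraT => ntcF; case: (unlinkA y A1y).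
  by apply: linked_Fitting => //; apply: G1 A1y.
have regFQ := unlink_reg Q sQG unlinkQ.
have nFQ := subset_trans sQG nFG.
have nFM := subset_trans sMG nFG.
(* Semiregularity makes [#|F|] and [#|Q|] coprime, so elements of [F] normalising [Q] centralise it
   and are trivial. *)
have tiFM : F :&: M = 1.
  have coFQ := regular_norm_coprime nFQ regFQ.
  rewrite setIA (setIidPl sFG) coprime_norm_cent //.
  exact: cent_semiregular regFQ (subxx _) ntQ.
have sdFM : F ><| M = G by rewrite sdprodE.
have sQM : Q \subset M by rewrite subsetI sQG normG.
have ntM : M :!=: 1 by apply: contraNneq ntQ => M1; rewrite -subG1 -M1.
have [regFM | ] := boolP [forall x in M^#, 'C_F[x] == 1].
  left; suffices frobG : [Frobenius G = F ><| M] by apply: FrobeniusW frobG.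
  apply/Frobenius_semiregularP => //.
  by move=> x M1x; apply/eqP/(forall_inP regFM).
rewrite negb_forall_in => /exists_inP[w /setD1P[ntw Mw] ntcFw].
right; have [x wx x_pr] := prime_order_power ntw.
have ntx : x != 1 by rewrite -order_gt1 prime_gt1.
have Mx : x \in M by apply: subsetP wx; rewrite cycle_subG.
have M1x : x \in M^# by rewrite in_setD1 ntx.
have linkxf : linked G x f.
  apply: linked_Fitting => //; first exact: G1 M1x.
  apply: contraNneq ntcFw => cFx; rewrite -subG1 -cFx setIS //.
  by case/cycleP: wx => i ->; apply/subsetP => k /cent1P ckw; apply/cent1P/commuteX.
pose Z := 'Z(Q)%G; have sZQ : Z \subset Q := center_sub Q.
have ntZ : Z :!=: 1 by rewrite (center_nil_eq1 (pgroup_nil (pHall_pgroup sylQ))).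
have cycZ : cyclic Z.
  apply: (@abelian_semiregular_cyclic _ F Z) => //.
  - exact: solvableS sFG solG.
  - exact: subset_trans sZQ nFQ.
  - exact: center_abelian.
  - exact: semiregularS (subxx _) sZQ regFQ.
have nZM : M \subset 'N(Z).
  apply: char_norm_trans (center_char Q) _; exact: subsetIr.
have [z0 Zz0 ntz0] := trivgPn _ ntZ.
have Q1z0 : z0 \in Q^# by rewrite !inE ntz0 (subsetP sZQ).
(* Nontrivial elements of [H] are linked to [z0], hence not to [f]; moreover [M / H] is abelian, as
   it embeds in [Aut Z]. *)
pose H := 'C_M(Z)%G.
have sHM : H \subset M := subsetIl _ _; have sHG := subset_trans sHM sMG.
have linkH h : h \in H^# -> linked G h z0.
  move=> H1h; apply: linked_commute; [exact: G1 H1h | exact: G1 Q1z0 |].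
  by case/setD1P: H1h => _ /setIP[_ /centP]; apply.
have unlinkH h : h \in H^# -> ~ linked G h f.
  move=> H1h lhf; apply: (unlinkQ z0 Q1z0).
  by apply: linked_trans lhf; rewrite linked_sym linkH.
have regFH := unlink_reg H sHG unlinkH.
have sZH : Z \subset H.
  rewrite subsetI (subset_trans sZQ sQM).
  exact: center_abelian.
have ntH : H :!=: 1 by apply: contraNneq ntZ => H1; rewrite -subG1 -H1.
have sM'H : M^`(1) \subset H.
  by rewrite subsetI der_sub der1_sub_cent_cyclic.
have nsHM : H <| M := sub_der1_normal sM'H sHM.
pose L := 'C_M[x]%G; have sLM : L \subset M := subsetIl _ _.
have sLG := subset_trans sLM sMG.
have L1link l : l \in L^# -> linked G l f.
  move=> L1l; apply: linked_trans linkxf; apply: linked_commute.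
  - exact: G1 L1l.
  - exact: G1 M1x.
  - by case/setD1P: L1l => _ /setIP[_ /cent1P].
(* A commuting pair of nontrivial elements of [H] and [L] would link [H] to [f], since [L] is linked
   to [f] through [x]. *)
have regHL : semiregular H L.
  move=> l L1l; apply/trivgP/subsetP => h /setIP[Hh chl]; rewrite inE.
  apply: contraT => nth; have H1h : h \in H^# by rewrite in_setD1 nth.
  case: (unlinkH h H1h); apply: linked_trans (L1link l L1l).
  apply: linked_commute; [exact: G1 H1h | exact: G1 L1l | exact/cent1P].
have frobM : [Frobenius M = H ><| L].
  apply: Frobenius_norm_cycle => //.
  apply/trivgP/subsetP => h /setIP[Hh chx]; rewrite inE; apply: contraT => nth.
  have H1h : h \in H^# by rewrite in_setD1 nth.
  case: (unlinkH h H1h); apply: linked_trans linkxf.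
  by apply: linked_commute; [exact: G1 H1h | exact: G1 M1x | exact/cent1P].
have nFH := subset_trans sHG nFG; have nFL := subset_trans sLG nFG.
have frobFH : [Frobenius F <*> H = F ><| H].
  apply/Frobenius_semiregularP => //.
  by rewrite sdprodEY //; apply/trivgP; rewrite -tiFM setIS.
have nFHG : G \subset 'N(F <*> H).
  have: F * M \subset 'N(F <*> H).
    apply: mul_subG; first exact: subset_trans (joing_subl F H) (normG _).
    by rewrite normsY ?(normal_norm nsHM).
  by rewrite (sdprodW sdFM).
have defGF : G / F = M / F by have := quotientMidl F M; rewrite (sdprodW sdFM).
exists F, H; split.
  exists (F <*> L)%G; rewrite /two_Frobenius_with -norm_joinEr //; split=> //.
  - by rewrite /normal join_subG sFG sHG.
  - by rewrite joing_subl join_subG sFG.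
  rewrite !quotientYidl // defGF.
  exact: Frobenius_quotient_disjoint.
move=> p r piHp piFr; apply/negP => pr1; apply: (unlinkQ z0 Q1z0).
have [p_pr r_pr] : prime p /\ prime r.
  by split; [move: piHp | move: piFr]; rewrite mem_primes => /andP[].
have pH : p %| #|H| by move: piHp; rewrite mem_primes => /and3P[].
have [h Hh oh] := Cauchy p_pr pH.
have H1h : h \in H^# by rewrite in_setD1 Hh -order_gt1 oh prime_gt1.
have [v F1v nvh] : exists2 v, v \in F^# & h \in 'N(<[v]>).
  (* [E] is an elementary abelian [r]-group, characteristic in [F] and hence normalised by [h]; as
     [p] divides [r - 1], [h] has an eigenvector in it. *)
  pose E := 'Ohm_1('Z('O_r(F)))%G.
  have chE : E \char F.
    exact: char_trans (Ohm_char _ _) (char_trans (center_char _) (pcore_char _ _)).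
  have rFr : r.-group 'O_r(F) := pcore_pgroup _ _.
  have ntE : E :!=: 1.
    rewrite Ohm1_eq1 (center_nil_eq1 (pgroup_nil rFr)) -cardG_gt1.
    by rewrite (card_Hall (nilpotent_pcore_Hall r (Fitting_nil G))) p_part_gt1.
  have abelE : r.-abelem E.
    by apply: Ohm1_abelem; [exact: pgroupS (center_sub _) rFr | exact: center_abelian].
  have nEh : h \in 'N(E).
    by apply: subsetP Hh; apply: char_norm_trans chE nFH.
  have [|v E1v nvh] := abelem_norm_cycle abelE ntE nEh; first by rewrite oh -subn1.
  by exists v => //; apply: subsetP E1v; apply/setSD/char_sub.
(* From [z0] to [f]: [<[z0]>] is characteristic in the cyclic group [Z], so [x] normalises it, and
   [x] reaches [f]. *)
apply/andP; split.
  have /andP[xf _] := linkxf; apply: connect_trans (connect1 _) xf.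
  rewrite /norm_arc /= (G1 _ _ sQG Q1z0) (G1 _ _ sMG M1x) /=.
  apply: subsetP Mx; apply: char_norm_trans nZM.
  by rewrite sub_cyclic_char // cycle_subG.
(* From [f] back to [z0], through [v] and then [h]. *)
have /andP[_ fv] := linked_nilpotent (Fitting_nil G) sFG F1v F1f.
apply: connect_trans fv _; have /andP[hz _] := linkH h H1h.
apply: connect_trans hz; apply: connect1.
by rewrite /norm_arc /= nvh (G1 _ _ sFG F1v) (G1 _ _ sHG H1h).
Qed.

Theorem theoremB (gT : finGroupType) (G : {group gT})
    (solG : solvable G) (trivZ : 'Z(G) = 1) :
  strongly_disconnected (Delta_norm G) <->
    ([Frobenius G] \/
     exists K H : {group gT},
       (exists L : {group gT}, two_Frobenius_with G K H L) /\
       (forall p r : nat, p \in \pi(H) -> r \in \pi(K) -> ~~ (p %| r - 1)%N)).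
Proof.
have [conn_arc arc_conn] := strongly_connectedP trivZ.
split=> [nconn | [frobG | [K [H [[L frobKHL] ndv]]]] /conn_arc].
- by apply: disconnected_Frobenius => // /arc_conn.
- exact: Frobenius_disconnected.
exact: two_Frobenius_disconnected frobKHL ndv.
Qed.
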